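(* Let $\mathcal G$ be a fixed, connected, undirected graph on $N\ge2$ nodes with Laplacian $L$, and let $W=I_N-\alpha L$ with $\alpha>0$. Let $\mathbf E_1,\dots,\mathbf E_N$ be the selector matrices of a block partition of $\mathbb R^d$, and let $u=\sum_{i=1}^N\mathbf E_iu_i\in\mathbb R^d$ with $u_i\in\mathbb R^{d_i}$. Consider the recursion on $\mathbb R^{Nd}$ $$\mathbf s^{t+1}=(W\otimes I_d)\mathbf s^t+\mathbf b(u),\qquad \mathbf b(u)=\mathrm{col}(\mathbf E_1u_1,\ldots,\mathbf E_Nu_N).$$ If $u\ne0$, this recursion admits no fixed point. If $u=0$, its fixed-point set is the consensus subspace $\{\mathbf 1_N\otimes v:v\in\mathbb R^d\}$. Consequently, $\mathbf 1_N\otimes u$ is never an isolated fixed point of this recursion.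
   Context: Graphs are simple and unweighted; $L$ is the combinatorial graph Laplacian. Selector matrices: $d=\sum_{i=1}^N d_i$ with $d\ge1$, vectors $u\in\mathbb R^d$ are partitioned as $u=[u_1^\top,\dots,u_N^\top]^\top$ with $u_i\in\mathbb R^{d_i}$, and $\mathbf E_i\in\{0,1\}^{d\times d_i}$ is the block-column of $I_d$ corresponding to the coordinates of $u_i$. Hence $\mathbf E_i^\top\mathbf E_i=I_{d_i}$, $\mathbf E_i^\top\mathbf E_j=0$ for $i\ne j$, and $\sum_i\mathbf E_i\mathbf E_i^\top=I_d$. $\mathrm{col}(x_1,\dots,x_N)$ is the vertical stack of vectors, $\mathbf 1_N\in\mathbb R^N$ is the all-ones vector, and $\otimes$ is the Kronecker product. A fixed point is isolated if it has a neighborhood containing no other fixed point. *)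

(* Defs.v *)
From mathcomp Require Import all_boot all_algebra.
From mathcomp Require Import classical_sets.
From mathcomp Require Export mxtens.

Set Implicit Arguments.
Unset Strict Implicit.
Unset Printing Implicit Defensive.

Import GRing.Theory.
Local Open Scope classical_set_scope.
Local Open Scope ring_scope.

Definition connected_graph (V : finType) (e : rel V) : Prop :=
  forall x y : V, connect e x y.

Definition degree (N : nat) (e : rel 'I_N) (i : 'I_N) : nat :=
  #|[set j | e i j]%SET|.

Definition laplacian (R : pzRingType) (N : nat) (e : rel 'I_N) : 'M[R]_N :=
  \matrix_(i, j) ((degree e i)%:R *+ (i == j) - (e i j)%:R).

Definition selector (R : pzRingType) (N : nat) (d_ : 'I_N -> nat)
    (i : 'I_N) : 'M[R]_(\sum_(k < N) d_ k, d_ i) :=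
  submxrow (1%:M : 'M[R]_(\sum_(k < N) d_ k)) i.

(* Coordinate [k] of the stack is coordinate [k %% d] of the block [k %/ d],
   the same indexing of ['I_(N * d)] as in the Kronecker product [*t].  The
   library's [\mxcol] would have height [\sum_(i < N) d], which is not
   convertible to [N * d]. *)
Definition stack (R : Type) (N d : nat) (x : 'I_N -> 'cV[R]_d) :
    'cV[R]_(N * d) :=
  \col_k x (mxtens_unindex k).1 (mxtens_unindex k).2 ord0.

(* The Kronecker product has [1 * 1] columns, which is convertible to [1]. *)
Definition consensus (R : pzRingType) (N d : nat) (v : 'cV[R]_d) :
    'cV[R]_(N * d) :=
  (const_mx 1 : 'cV[R]_N) *t v.

Definition forcing (R : pzRingType) (N : nat) (d_ : 'I_N -> nat)
    (u_ : forall i : 'I_N, 'cV[R]_(d_ i)) :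
    'cV[R]_(N * \sum_(k < N) d_ k) :=
  stack (fun i => selector R d_ i *m u_ i).

Definition recursion_step (R : pzRingType) (N : nat) (d_ : 'I_N -> nat)
    (W : 'M[R]_N) (u_ : forall i : 'I_N, 'cV[R]_(d_ i))
    (s : 'cV[R]_(N * \sum_(k < N) d_ k)) : 'cV[R]_(N * \sum_(k < N) d_ k) :=
  (W *t (1%:M : 'M[R]_(\sum_(k < N) d_ k))) *m s + forcing u_.

Definition fixed_points (T : Type) (f : T -> T) : set T := [set s | f s = s].

(* Main.v *)
Require Import Defs.
From HB Require Import structures.
From mathcomp Require Import all_boot all_order all_algebra.
From mathcomp Require Import all_classical all_reals all_analysis.

Set Implicit Arguments.
Unset Strict Implicit.
Unset Printing Implicit Defensive.

Import Order.TTheory GRing.Theory Num.Theory.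
Import numFieldNormedType.Exports.
Local Open Scope classical_set_scope.
Local Open Scope ring_scope.

(* Summing [alpha (L s)_i = E_i u_i] over the nodes kills the left side, since
   the columns of [L] sum to zero, and leaves [0 = u].  When [u = 0] every [u_i]
   vanishes, and the equation says that each coordinate of [s] lies in the
   kernel of [L], which is spanned by the all-ones vector because
   [2 x^T L x] is the sum of [(x_i - x_j)^2] over ordered pairs of neighbours.
   The resulting fixed-point set is a nonzero linear subspace, so it has no
   isolated point at the origin. *)

Lemma laplacian_mulE (R : pzRingType) (N : nat) (e : rel 'I_N) (x : 'cV[R]_N)
    (i : 'I_N) :
  (laplacian R e *m x) i ord0 = \sum_j (e i j)%:R * (x i ord0 - x j ord0).
Proof.
rewrite mxE; under eq_bigr do rewrite mxE mulrBl.
under [RHS]eq_bigr do rewrite mulrBr.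
rewrite !sumrB; congr (_ - _).
rewrite (bigD1 i)//= big1 => [|j /negPf ji]; last by rewrite eq_sym ji mul0r.
rewrite eqxx addr0 -mulr_suml -natr_sum; congr (_%:R * _).
by rewrite /degree -sum1dep_card big_mkcond.
Qed.

(** Swapping the two summation indices exchanges the [x i] and [x j] contributions, because
    adjacency is symmetric. *)
Lemma sum_laplacian_mul (R : pzRingType) (N : nat) (e : rel 'I_N)
    (e_sym : symmetric e) (x : 'cV[R]_N) :
  \sum_i (laplacian R e *m x) i ord0 = 0.
Proof.
under eq_bigr do [rewrite laplacian_mulE; under eq_bigr do rewrite mulrBr].
under eq_bigr do rewrite sumrB.
rewrite sumrB [X in _ - X]exchange_big/=.
by under [X in _ - X]eq_bigr do under eq_bigr do rewrite e_sym; rewrite subrr.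
Qed.

(** Writing [g i j] for the edge difference, each square splits as [x_i g_ij + x_j g_ji];
    relabelling the second half turns it into the first, whence the factor 2. *)
Lemma laplacian_form (R : comPzRingType) (N : nat) (e : rel 'I_N)
    (e_sym : symmetric e) (x : 'cV[R]_N) :
  \sum_i \sum_j (e i j)%:R * (x i ord0 - x j ord0) ^+ 2 =
  (\sum_i x i ord0 * (laplacian R e *m x) i ord0) *+ 2.
Proof.
pose g i j := (e i j)%:R * (x i ord0 - x j ord0).
transitivity (\sum_i \sum_j (x i ord0 * g i j + x j ord0 * g j i)).
  apply: eq_bigr => i _; apply: eq_bigr => j _.
  rewrite /g (e_sym j i) !(mulrCA (x _ _)) -mulrDr.
  by rewrite -(opprB (x i _)) mulrN -mulrBl.
under eq_bigr do rewrite big_split/=.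
rewrite big_split/= [X in _ + X]exchange_big/= mulr2n.
by under [in RHS]eq_bigr do rewrite laplacian_mulE mulr_sumr.
Qed.

Lemma laplacian_kernel (R : realDomainType) (N : nat) (e : rel 'I_N)
    (e_sym : symmetric e) (e_conn : connected_graph e) (x : 'cV[R]_N) :
  laplacian R e *m x = 0 -> forall i j, x i ord0 = x j ord0.
Proof.
move=> Lx0.
have term_ge0 i j : 0 <= (e i j)%:R * (x i ord0 - x j ord0) ^+ 2.
  by rewrite mulr_ge0 ?sqr_ge0.
have form0 : \sum_i \sum_j (e i j)%:R * (x i ord0 - x j ord0) ^+ 2 = 0.
  rewrite laplacian_form// Lx0.
  by under eq_bigr do rewrite mxE mulr0; rewrite big1 ?mul0rn.
have edge i j : e i j -> x i ord0 = x j ord0.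
  move=> eij.
  have /psumr_eq0P row0 := form0.
  have /psumr_eq0P entry0 :=
    row0 (fun i _ => sumr_ge0 _ (fun j _ => term_ge0 i j)) i isT.
  have /eqP := entry0 (fun j _ => term_ge0 i j) j isT.
  by rewrite eij mul1r sqrf_eq0 subr_eq0 => /eqP.
(* The nodes where [x] takes its value at [i] are closed under adjacency, so by connectedness they
   include [j]. *)
move=> i j; apply/eqP; pose a := [pred k | x i ord0 == x k ord0].
have a_closed : fingraph.closed e a.
  apply: (intro_closed (sym_connect_sym e_sym)) => k l /edge kl.
  by rewrite !inE kl.
by have := closed_connect a_closed (e_conn i j); rewrite !inE eqxx.
Qed.

(** The selectors side by side form the identity matrix. This lets each [u_ i] be recovered as a
    block of [u]. *)
Lemma sum_selector (R : pzRingType) (N : nat) (d_ : 'I_N -> nat)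
    (u_ : forall i : 'I_N, 'cV[R]_(d_ i)) :
  \sum_i selector R d_ i *m u_ i = \mxcol_i u_ i.
Proof. by rewrite -mul_mxrow_mxcol submxrowK mul1mx. Qed.

(* Coordinate [c] of every block, so that [W *t 1%:M] acts on each slice as
   [W]. *)
Definition coord_slice (R : Type) (N d : nat) (s : 'cV[R]_(N * d)) (c : 'I_d) :
    'cV[R]_N :=
  \col_i s (mxtens_index (i, c)) ord0.

Lemma coord_sliceP (R : Type) (N d : nat) (s t : 'cV[R]_(N * d)) :
  (forall c, coord_slice s c = coord_slice t c) <-> s = t.
Proof.
split=> [st|->//]; apply/colP => k; case: (mxtens_indexP k) => i c.
by have /colP/(_ i) := st c; rewrite !mxE.
Qed.

Lemma coord_slice_tens1 (R : pzRingType) (N d : nat) (A : 'M[R]_N)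
    (s : 'cV[R]_(N * d)) (c : 'I_d) :
  coord_slice ((A *t (1%:M : 'M[R]_d)) *m s) c = A *m coord_slice s c.
Proof.
apply/colP => i; rewrite !mxE.
rewrite (reindex (@mxtens_index N d)); last first.
  by exists (@mxtens_unindex N d) => k _;
    rewrite ?mxtens_indexK ?mxtens_unindexK.
transitivity (\sum_j \sum_b (A *t 1%:M) (mxtens_index (i, c))
    (mxtens_index (j, b)) * s (mxtens_index (j, b)) ord0).
  by rewrite pair_bigA; apply: eq_bigr => -[j b].
apply: eq_bigr => j _; rewrite (bigD1 c)//= big1 => [|b /negPf bc].
  by rewrite tensmxE !mxE eqxx mulr1 addr0.
by rewrite tensmxE !mxE eq_sym bc mulr0 mul0r.
Qed.

Lemma coord_slice_forcing (R : pzRingType) (N : nat) (d_ : 'I_N -> nat)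
    (u_ : forall i : 'I_N, 'cV[R]_(d_ i)) c i :
  coord_slice (forcing u_) c i ord0 = (selector R d_ i *m u_ i) c ord0.
Proof. by rewrite mxE [LHS]mxE mxtens_indexK. Qed.

Lemma coord_slice_consensus (R : pzRingType) (N d : nat) (v : 'cV[R]_d) c i :
  coord_slice (consensus N v) c i ord0 = v c ord0.
Proof.
rewrite !mxE mul1r mxtens_indexK/=; congr (v _ _); exact: val_inj.
Qed.

Lemma consensusZ (R : comPzRingType) (N d : nat) (a : R) (v : 'cV[R]_d) :
  consensus N (a *: v) = a *: consensus N v.
Proof. by apply/matrixP => i j; rewrite !mxE mulrCA. Qed.

(** The identity part of [1 - L] cancels against [s], and the Kronecker factor [1%:M] decouples the
    coordinates into separate Laplacian equations. *)
Lemma fixed_point_slice (R : pzRingType) (N : nat) (L : 'M[R]_N)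
    (d_ : 'I_N -> nat) (u_ : forall i : 'I_N, 'cV[R]_(d_ i))
    (s : 'cV[R]_(N * \sum_(k < N) d_ k)) :
  recursion_step (1%:M - L) u_ s = s <->
  forall c, L *m coord_slice s c = coord_slice (forcing u_) c.
Proof.
have slice c : coord_slice (recursion_step (1%:M - L) u_ s) c =
    coord_slice s c - L *m coord_slice s c + coord_slice (forcing u_) c.
  transitivity (coord_slice (((1%:M - L) *t 1%:M : 'M[R]_(N * _)) *m s) c +
                coord_slice (forcing u_) c).
    by apply/colP => i; rewrite !mxE.
  by rewrite coord_slice_tens1 mulmxBl mul1mx.
split=> [sE c|LE].
  have := slice c; rewrite sE -addrA -[LHS]addr0 => /addrI/esym/eqP.
  by rewrite addrC subr_eq0 => /eqP.
by apply/coord_sliceP => c; rewrite slice LE subrK.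
Qed.

(** Scalar multiplication is continuous, so small nonzero multiples of [w] enter every neighborhood
    of the origin. *)
Lemma scale_not_isolated0 (R : realFieldType) (V : normedModType R)
    (A : set V) (w : V) :
  w != 0 -> (forall a : R, A (a *: w)) -> ~ isolated A 0.
Proof.
move=> w0 Aw [_ [U U0 UA]].
have : \forall a \near (0 : R), U (a *: w).
  by apply: (@scalel_continuous _ _ w 0); rewrite scale0r.
move=> /nbhs_ballP[r /= r0 rU].
(* Half the radius is a nonzero scalar still inside the open ball. *)
have : (U `&` A) ((r / 2) *: w).
  split; [apply: rU|exact: Aw].
  by rewrite /ball/= sub0r normrN gtr0_norm ?divr_gt0// gtr_pMr//
    invf_lt1// ltr1n.
rewrite UA => /eqP.
by rewrite scaler_eq0 (negPf w0) orbF mulf_eq0 invr_eq0 pnatr_eq0 orbF gt_eqF.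
Qed.

Theorem proposition1 (R : realType) (N : nat) (hN : (2 <= N)%N)
    (e : rel 'I_N) (e_sym : symmetric e) (e_irr : irreflexive e)
    (e_conn : connected_graph e)
    (alpha : R) (alpha_gt0 : 0 < alpha)
    (W : 'M[R]_N) (hW : W = 1%:M - alpha *: laplacian R e)
    (d_ : 'I_N -> nat) (hd : (1 <= \sum_(i < N) d_ i)%N)
    (u_ : forall i : 'I_N, 'cV[R]_(d_ i))
    (u : 'cV[R]_(\sum_(i < N) d_ i))
    (hu : u = \sum_(i < N) selector R d_ i *m u_ i) :
  [/\ u <> 0 -> fixed_points (recursion_step W u_) = set0,
      u = 0 -> fixed_points (recursion_step W u_) =
               [set consensus N v | v in [set: 'cV[R]_(\sum_(i < N) d_ i)]]
    & ~ isolated (fixed_points (recursion_step W u_)) (consensus N u)].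
Proof.
have no_fixed : u <> 0 -> fixed_points (recursion_step W u_) = set0.
  move=> u_neq0; rewrite -subset0 => s; rewrite /fixed_points/= hW.
  move=> /fixed_point_slice sE; apply: u_neq0; apply/colP => c.
  rewrite hu summxE mxE; under eq_bigr do rewrite -coord_slice_forcing -sE.
  under eq_bigr do rewrite -scalemxAl mxE.
  by rewrite -mulr_sumr sum_laplacian_mul// mulr0.
(* A reference node, at which the consensus value of a fixed point is read off. *)
have i0 : 'I_N := Ordinal (ltnW hN).
have fixed_consensus : u = 0 -> fixed_points (recursion_step W u_) =
    [set consensus N v | v in [set: 'cV[R]_(\sum_(i < N) d_ i)]].
  move=> u0.
  have forcing0 c : coord_slice (forcing u_) c = 0.
    apply/colP => i; rewrite coord_slice_forcing.
    have -> : u_ i = 0 by rewrite -(mxcolK u_ i) -sum_selector -hu u0 submxcol0.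
    by rewrite mulmx0 !mxE.
  apply/seteqP; split=> [s|_ [v _ <-]]; rewrite /fixed_points/= hW.
    move=> /fixed_point_slice sE.
    exists (\col_c coord_slice s c i0 ord0) => //.
    apply/coord_sliceP => c; apply/colP => i.
    rewrite coord_slice_consensus mxE; apply: (laplacian_kernel e_sym e_conn).
    apply/eqP; have /eqP := sE c.
    by rewrite forcing0 -scalemxAl scaler_eq0 gt_eqF.
  apply/fixed_point_slice => c; rewrite forcing0 -scalemxAl.
  apply/colP => i; rewrite [LHS]mxE [RHS]mxE laplacian_mulE.
  rewrite big1 ?mulr0// => j _.
  by rewrite !coord_slice_consensus subrr mulr0.
(* An isolated point belongs to its set, which is empty when [u] is nonzero. *)
split=> //; have [u0|/eqP/no_fixed ->] := eqVneq u 0; last by move/isolatedS.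
rewrite (fixed_consensus u0) u0.
(* The all-ones consensus direction; it is nonzero because there is a node and [hd] supplies a
   coordinate. *)
pose w : 'cV[R]_(N * _) :=
  consensus N (const_mx 1 : 'cV[R]_(\sum_(i < N) d_ i)).
have -> : consensus N (0 : 'cV[R]_(\sum_(i < N) d_ i)) = 0.
  by apply/colP => k; rewrite !mxE mulr0.
apply: (@scale_not_isolated0 _ _ _ w) => [|a].
  apply/eqP => /coord_sliceP/(_ (Ordinal hd))/colP/(_ i0).
  by rewrite coord_slice_consensus !mxE => /eqP; rewrite oner_eq0.
by exists (a *: const_mx 1) => //; exact: consensusZ.
Qed.
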